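(* Let $M_1,M_2$ be monoids with a common submonoid $W$ and let $L=M_1\ast_W M_2$ be the amalgamated free product. Let $T$ be the graph with vertex set $V=L/M_1\coprod L/M_2$ and edge set $E=L/W$, where for each $x\in L$ the edge $[x]_W$ connects the vertex $[x]_{M_1}$ to the vertex $[x]_{M_2}$. Then $T$ is a tree.
   Context: $M_1\ast_W M_2$ is the pushout, in the category of monoids, of the inclusions $W\to M_1$ and $W\to M_2$. Each $K\in\{M_1,M_2,W\}$ acts on the right of $L$ by first applying the canonical homomorphism $K\to L$ (not necessarily injective) and then right multiplying. $L/K$ denotes the set of weak orbits, i.e. the quotient of $L$ by the equivalence relation generated by $x\sim xk$ for $x\in L$, $k\in K$, and $[x]_K$ denotes the class of $x$. The incidence in $T$ is well defined. *)

(* Defs.v *)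
From HB Require Import structures.
From Stdlib Require Import Relation_Operators.
From mathcomp Require Import all_boot.
From mathcomp Require Import boolp.

Set Implicit Arguments.
Unset Strict Implicit.
Unset Printing Implicit Defensive.

Local Open Scope group_scope.
Local Open Scope quotient_scope.

(* A [monoidType] carries a choice structure; classically every monoid does,
   so ranging over [monoidType] is no restriction. *)
Notation monoid_hom := UMagmaMorphism.type.

(* The cocone (j1, j2) is the pushout of (i1, i2) in the category of monoids.
   Uniqueness of the mediating morphism is pointwise. *)
Definition is_pushout (W M1 M2 L : monoidType)
    (i1 : monoid_hom W M1) (i2 : monoid_hom W M2)
    (j1 : monoid_hom M1 L) (j2 : monoid_hom M2 L) : Prop :=
  j1 \o i1 =1 j2 \o i2 /\
  forall (N : monoidType) (f1 : monoid_hom M1 N) (f2 : monoid_hom M2 N),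
    f1 \o i1 =1 f2 \o i2 ->
    exists f : monoid_hom L N,
      [/\ f \o j1 =1 f1, f \o j2 =1 f2
        & forall g : monoid_hom L N,
            g \o j1 =1 f1 -> g \o j2 =1 f2 -> g =1 f].

Section WeakOrbits.

Variables (K L : monoidType) (phi : monoid_hom K L).

Definition orbit_step (x y : L) : Prop := exists k : K, y = x * phi k.

Definition weak_orbit : rel L := fun x y => `[< clos_refl_sym_trans L orbit_step x y >].

Lemma weak_orbit_refl : reflexive weak_orbit.
Proof. by move=> x; apply/asboolP; exact: rst_refl. Qed.

Lemma weak_orbit_sym : symmetric weak_orbit.
Proof. by move=> x y; apply/asboolP/asboolP => ?; exact: rst_sym. Qed.

Lemma weak_orbit_trans : transitive weak_orbit.
Proof.
by move=> y x z /asboolP xy /asboolP yz; apply/asboolP; exact: rst_trans xy yz.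
Qed.

Canonical weak_orbit_equiv :=
  EquivRel weak_orbit weak_orbit_refl weak_orbit_sym weak_orbit_trans.

Definition weak_orbits : choiceType := {eq_quot weak_orbit}.

Definition orbit_class (x : L) : weak_orbits := \pi_({eq_quot weak_orbit}) x.

Definition orbit_repr (c : weak_orbits) : L := repr c.

Lemma orbit_reprK : cancel orbit_repr orbit_class.
Proof. exact: reprK. Qed.

Lemma orbit_classP (x y : L) :
  orbit_class x = orbit_class y <-> clos_refl_sym_trans L orbit_step x y.
Proof.
by split=> [/eqmodP/asboolP|xy] //; apply/eqmodP/asboolP.
Qed.

End WeakOrbits.

(* Undirected multigraphs, loops and parallel edges allowed: the edge e joins
   [endpoint e false] and [endpoint e true]. *)
Record graph := Graph {
  vertex : eqType;
  edge : eqType;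
  endpoint : edge -> bool -> vertex
}.

Section Graphs.

Variable T : graph.

(* (e, b) is the edge e traversed from [endpoint e b] to [endpoint e (~~ b)]. *)
Definition dart := (edge T * bool)%type.
Definition dart_source (d : dart) : vertex T := endpoint d.1 d.2.
Definition dart_target (d : dart) : vertex T := endpoint d.1 (~~ d.2).

Fixpoint walk (x : vertex T) (p : seq dart) (y : vertex T) : bool :=
  if p is d :: p' then (dart_source d == x) && walk (dart_target d) p' y
  else x == y.

Definition connected_graph : Prop :=
  inhabited (vertex T) /\ forall x y : vertex T, exists p, walk x p y.

(* Distinctness of the edges excludes going back and forth along one edge;
   loops and pairs of parallel edges are circuits of length 1 and 2. *)
Definition circuit (x : vertex T) (p : seq dart) : Prop :=
  [/\ p != [::], walk x p x, uniq [seq d.1 | d <- p]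
    & uniq [seq dart_source d | d <- p]].

Definition is_tree : Prop :=
  connected_graph /\ forall x p, ~ circuit x p.

End Graphs.

Section AmalgamGraph.

Variables (W M1 M2 L : monoidType).
Variables (i1 : monoid_hom W M1) (i2 : monoid_hom W M2).
Variables (j1 : monoid_hom M1 L) (j2 : monoid_hom M2 L).

(* W acts on L through M1; when j1 \o i1 =1 j2 \o i2 it is the same through M2. *)
Definition amalgam_hom : monoid_hom W L := j1 \o i1.

Definition amalgam_vertex : eqType :=
  (weak_orbits j1 + weak_orbits j2)%type.

Definition amalgam_edge : eqType := weak_orbits amalgam_hom.

(* Defined on a chosen representative; see [amalgam_endpointE] for the
   independence of the choice. *)
Definition amalgam_endpoint (e : amalgam_edge) (b : bool) : amalgam_vertex :=
  let x := orbit_repr e in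
  if b then inr (orbit_class j2 x) else inl (orbit_class j1 x).

Definition amalgam_graph : graph := Graph amalgam_endpoint.

Lemma amalgam_endpointE (x : L) (b : bool) :
  j1 \o i1 =1 j2 \o i2 ->
  amalgam_endpoint (orbit_class amalgam_hom x) b =
  if b then inr (orbit_class j2 x) else inl (orbit_class j1 x).
Proof.
move=> jE; set e := orbit_class _ x.
have : clos_refl_sym_trans L (orbit_step amalgam_hom) (orbit_repr e) x.
  by apply/orbit_classP; rewrite orbit_reprK.
rewrite /amalgam_endpoint; elim=> {e x} [x _ [w ->]|//|y z _ -> //|y z t _ -> _ -> //].
case: b.
- congr inr; apply/orbit_classP/rst_step; exists (i2 w).
  by rewrite -[j2 (i2 w)]jE.
- by congr inl; apply/orbit_classP/rst_step; exists (i1 w).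
Qed.

End AmalgamGraph.

(* Main.v *)
From HB Require Import structures.
From Stdlib Require Import Relation_Operators.
Require Import Defs.
From mathcomp Require Import all_boot.
From mathcomp Require Import boolp.

(** Mod 2 coefficients suffice, because a circuit crosses each of its edges
    exactly once. For [c : L -> bool], the coboundary [k |-> (a |-> c (a k) - c a)]
    is a derivation, i.e. a homomorphism into the wreath product of [F_2] by [L].
    Existence in the pushout glues the coboundary of [0] on [M1] and that of [c]
    on [M2], whenever [c] is constant on the weak [W]-orbits, into a derivation
    of [L]; its value at [a = 1] is a function [h] on [L] which is
    [M1]-invariant while [h - c] is [M2]-invariant, so [h] and [h - c] form a
    labelling of the vertices whose variation along the edge [[x]_W] is [c x].
    Taking for [c] the indicator of one edge shows that no circuit contains it.
    Uniqueness in the pushout shows that a function invariant under [M1] and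
    [M2] is invariant under [L], which gives connectedness. *)

Set Implicit Arguments.
Unset Strict Implicit.
Unset Printing Implicit Defensive.

Local Open Scope group_scope.

Definition wreath (L : monoidType) : Type := (L * (L -> bool))%type.

Section Wreath.

Variable L : monoidType.

HB.instance Definition _ := Choice.on (wreath L).

(** Semidirect product for the action of [L] on functions by translating the argument, [f] going to
    [a |-> f (a * x)]. *)
Definition wreath_mul (u v : wreath L) : wreath L :=
  (u.1 * v.1, fun a => u.2 a (+) v.2 (a * u.1)).

Definition wreath_one : wreath L := (1, fun=> false).

Lemma wreath_mulA : associative wreath_mul.
Proof.
move=> u v w; congr pair; first exact: mulgA.
by apply: funext => a /=; rewrite addbA mulgA.
Qed.

Lemma wreath_mul1 : left_id wreath_one wreath_mul.
Proof.
move=> [x f]; congr pair; first exact: mul1g.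
by apply: funext => a /=; rewrite mulg1.
Qed.

Lemma wreath_mulr1 : right_id wreath_one wreath_mul.
Proof.
move=> [x f]; congr pair; first exact: mulg1.
by apply: funext => a /=; rewrite addbF.
Qed.

HB.instance Definition _ :=
  isMonoid.Build (wreath L) wreath_mulA wreath_mul1 wreath_mulr1.

Definition wreath_fst (u : wreath L) : L := u.1.

Lemma wreath_fst_morphism : monoid_morphism wreath_fst.
Proof. by []. Qed.

HB.instance Definition _ :=
  isUMagmaMorphism.Build (wreath L) L wreath_fst wreath_fst_morphism.

Variables (K : monoidType) (phi : monoid_hom K L) (c : L -> bool).

Definition coboundary (k : K) : wreath L :=
  (phi k, fun a => c (a * phi k) (+) c a).

(** Telescoping: the variation of [c] from [a] to [a * phi k * phi l] is the sum of those over the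
    two successive steps. *)
Lemma coboundary_morphism : monoid_morphism coboundary.
Proof.
split=> [|k l].
  by congr pair; rewrite gmulf1 //; apply: funext => a; rewrite mulg1 addbb.
congr pair; first exact: gmulfM.
apply: funext => a /=; rewrite gmulfM mulgA.
by rewrite [RHS]addbC addbA addbK.
Qed.

HB.instance Definition _ :=
  isUMagmaMorphism.Build K (wreath L) coboundary coboundary_morphism.

End Wreath.

Section Pushout.

Variables (W M1 M2 L : monoidType).
Variables (i1 : monoid_hom W M1) (i2 : monoid_hom W M2).
Variables (j1 : monoid_hom M1 L) (j2 : monoid_hom M2 L).
Hypothesis L_pushout : is_pushout i1 i2 j1 j2.

Lemma pushout_hom_eq (N : monoidType) (g h : monoid_hom L N) :
  g \o j1 =1 h \o j1 -> g \o j2 =1 h \o j2 -> g =1 h.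
Proof.
move=> gh1 gh2; case: L_pushout => jE univ.
have hE : (h \o j1) \o i1 =1 (h \o j2) \o i2.
  by move=> w /=; congr (h _); exact: jE.
have [f [_ _ f_uniq]] := univ N (h \o j1) (h \o j2) hE.
by move=> x; rewrite (f_uniq g) // -(f_uniq h).
Qed.

(** The coboundaries of [c] and of zero agree on the images of [M1] and [M2], hence on [L]; evaluate
    at [a = 1]. *)
Lemma pushout_invariant (c : L -> bool) :
  (forall a m, c (a * j1 m) = c a) -> (forall a m, c (a * j2 m) = c a) ->
  forall x, c x = c 1.
Proof.
move=> c1 c2 x.
have cE : coboundary idfun c =1 coboundary idfun (fun=> false) :> (L -> _).
  apply: pushout_hom_eq => m /=; congr pair; apply: funext => a /=.
  - by rewrite c1 addbb.
  - by rewrite c2 addbb.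
have := congr1 (fun u : wreath L => u.2 1) (cE x).
by rewrite /= mul1g; case: (c x) (c 1) => [] [].
Qed.

Lemma pushout_potential (c : L -> bool) :
  (forall a w, c (a * j2 (i2 w)) = c a) ->
  exists h : L -> bool,
    (forall x m, h (x * j1 m) = h x) /\
    (forall x m, h (x * j2 m) (+) c (x * j2 m) = h x (+) c x).
Proof.
move=> cW; have [jE univ] := L_pushout.
have cobE : coboundary j1 (fun=> false) \o i1 =1 coboundary j2 c \o i2.
  move=> w; congr pair; first exact: jE.
  by apply: funext => a /=; rewrite cW addbb.
have [f [f1 f2 _]] := univ _ _ _ cobE.
(* By uniqueness [f] lifts the identity of [L], so its second component is a derivation. *)
have f_fst : @wreath_fst L \o f =1 idfun.
  apply: pushout_hom_eq => m.
  - by rewrite /= [f _]f1.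
  - by rewrite /= [f _]f2.
exists (fun x => (f x).2 1).
have fM x y : (f (x * y)).2 1 = (f x).2 1 (+) (f y).2 x.
  by rewrite gmulfM /= mul1g [(f x).1]f_fst.
split=> x m; rewrite fM.
- by rewrite [f (j1 m)]f1 addbF.
- by rewrite [f (j2 m)]f2 /= addbAC addbA addbK.
Qed.

End Pushout.

Section Walks.

Variable T : graph.

Definition reachable (x y : vertex T) : Prop := exists p, walk x p y.

Lemma reachable_trans x y z : reachable x y -> reachable y z -> reachable x z.
Proof.
move=> [p xy] [q yz]; exists (p ++ q).
elim: p x xy => [|d p IHp] x /= => [/eqP->//|/andP[-> /IHp //]].
Qed.

Lemma reachable_endpoint (e : edge T) (b : bool) :
  reachable (endpoint e b) (endpoint e (~~ b)).
Proof. by exists [:: (e, b)]; rewrite /= !eqxx. Qed.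

Lemma reachable_sym x y : reachable x y -> reachable y x.
Proof.
case=> p; elim: p x => [|[e b] p IHp] x /=.
  by move/eqP->; exists [::] => /=.
case/andP=> /eqP <- /IHp yd; apply: reachable_trans yd _.
rewrite /dart_source /dart_target /= -{2}[b]negbK.
exact: reachable_endpoint.
Qed.

Lemma walk_label (g : vertex T -> bool) (e0 : edge T) x p y :
  (forall e, e != e0 -> g (endpoint e true) = g (endpoint e false)) ->
  e0 \notin [seq d.1 | d <- p] -> walk x p y -> g x = g y.
Proof.
move=> gE; elim: p x => [|[e b] p IHp] x /=; first by move=> _ /eqP->.
rewrite inE negb_or eq_sym => /andP[/gE ge e0p] /andP[/eqP <- /(IHp _ e0p) <-].
by rewrite /dart_source /dart_target /=; case: b.
Qed.

(** After its first edge [e0], a circuit returns to its start without crossing [e0] again. A label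
    varying only across [e0] would be constant on that return, yet differ at its two ends. *)
Lemma circuit_free :
  (forall e0 : edge T, exists g : vertex T -> bool,
     forall e, g (endpoint e false) (+) g (endpoint e true) = (e == e0)) ->
  forall x p, ~ @circuit T x p.
Proof.
move=> sep x [|[e0 b] p] [] // _ /= /andP[/eqP <- wp] /andP[e0p _] _.
have [g gE] := sep e0.
have gE' e : e != e0 -> g (endpoint e true) = g (endpoint e false).
  by move=> /negbTE ne; apply/esym/eqP; rewrite -[_ == _]negbK negb_eqb gE ne.
have := walk_label gE' e0p wp; have := gE e0.
rewrite /dart_source /dart_target /= eqxx.
by case: b {wp}; case: (g _); case: (g _).
Qed.

End Walks.

Section Orbits.

Variables (K L : monoidType) (phi : monoid_hom K L).

Lemma orbit_classM (x : L) (k : K) :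
  orbit_class phi (x * phi k) = orbit_class phi x.
Proof. by apply/esym/orbit_classP/rst_step; exists k. Qed.

(** Lets an invariant function on [L] descend to weak orbits through chosen representatives. *)
Lemma orbit_repr_invariant (A : Type) (h : L -> A) (x : L) :
  (forall a k, h (a * phi k) = h a) ->
  h (orbit_repr (orbit_class phi x)) = h x.
Proof.
move=> hK; set y := orbit_repr _.
have : clos_refl_sym_trans L (orbit_step phi) y x.
  by apply/orbit_classP; rewrite orbit_reprK.
by elim=> {y x} [x _ [k ->]|//|y z _ -> //|y z t _ -> _ ->].
Qed.

End Orbits.

Section Amalgam.

Variables (W M1 M2 L : monoidType).
Variables (i1 : monoid_hom W M1) (i2 : monoid_hom W M2).
Variables (j1 : monoid_hom M1 L) (j2 : monoid_hom M2 L).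
Hypothesis L_pushout : is_pushout i1 i2 j1 j2.

Local Notation T := (amalgam_graph i1 j1 j2).
Local Notation vertex1 x := (inl (orbit_class j1 x) : vertex T).
Local Notation vertex2 x := (inr (orbit_class j2 x) : vertex T).

Lemma amalgam_reachable12 (x : L) : reachable (vertex1 x) (vertex2 x).
Proof.
have [jE _] := L_pushout.
rewrite -[vertex1 x](amalgam_endpointE x false jE).
rewrite -[vertex2 x](amalgam_endpointE x true jE).
exact: (@reachable_endpoint T (orbit_class (amalgam_hom i1 j1) x) false).
Qed.

Lemma amalgam_connected : connected_graph T.
Proof.
split; first exact: inhabits (vertex1 1).
have reach1 x : reachable (vertex1 1) (vertex1 x).
  pose c y := `[< reachable (vertex1 1) (vertex1 y) >].
  apply/asboolP; rewrite -/(c x).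
  rewrite (pushout_invariant L_pushout) => [|a m|a m].
  - by apply/asboolP; exists [::] => /=.
  - by rewrite /c orbit_classM.
  (* Two edges suffice: those of [a] and of [a * j2 m] meet at their common [M2]-orbit. *)
  have am : reachable (vertex1 a) (vertex1 (a * j2 m)).
    apply: reachable_trans (amalgam_reachable12 a) _.
    rewrite -(orbit_classM j2 a m).
    exact: reachable_sym (amalgam_reachable12 _).
  apply/asboolP/asboolP => r; apply: reachable_trans r _ => //.
  exact: reachable_sym.
have reach v : reachable (vertex1 1) v.
  case: v => q; rewrite -(orbit_reprK q); first exact: reach1.
  exact: reachable_trans (reach1 _) (amalgam_reachable12 _).
by move=> u v; apply: reachable_trans (reach v); apply: reachable_sym.
Qed.

Lemma amalgam_edge_label (e0 : edge T) :
  exists g : vertex T -> bool,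
    forall e, g (endpoint e false) (+) g (endpoint e true) = (e == e0).
Proof.
have [jE _] := L_pushout.
pose c x := orbit_class (amalgam_hom i1 j1) x == e0.
have cW a w : c (a * j2 (i2 w)) = c a.
  by rewrite /c -[j2 _]jE -(orbit_classM _ a w).
have [h [h1 h2]] := pushout_potential L_pushout cW.
exists (fun v => match v with
  | inl q => h (orbit_repr q)
  | inr q => h (orbit_repr q) (+) c (orbit_repr q)
  end) => e /=.
(* The label reads a representative of the orbit of [orbit_repr e]; invariance brings both values
   back to [orbit_repr e], where the two copies of [h] cancel mod 2. *)
rewrite (orbit_repr_invariant _ h1).
rewrite (orbit_repr_invariant (h := fun y => h y (+) c y) _ h2).
by rewrite addbA addbb /c orbit_reprK.
Qed.

End Amalgam.

Theorem lemma4p2 (W M1 M2 L : monoidType)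
    (i1 : monoid_hom W M1) (i2 : monoid_hom W M2)
    (j1 : monoid_hom M1 L) (j2 : monoid_hom M2 L)
    (i1_inj : injective i1) (i2_inj : injective i2)
    (L_pushout : is_pushout i1 i2 j1 j2) :
  is_tree (amalgam_graph i1 j1 j2).
Proof.
split; first exact: amalgam_connected L_pushout.
exact: circuit_free (amalgam_edge_label L_pushout).
Qed.
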